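(* Let $k\ge 1$ be an integer and let $P\in\mathbb{R}$ satisfy $P\le k^2$. Let $(\alpha,\beta)\in\mathbb{R}^2$ with $(\alpha,\beta)\neq(0,0)$, and let $\Theta_k$ be the solution of $$\ddot{\Theta}_k(t)+k^2(k^2-P)\Theta_k(t)+k^4\Theta_k(t)^3=0,\qquad \Theta_k(0)=\alpha,\quad \dot\Theta_k(0)=\beta ,$$ so that its energy $E=E(\alpha,\beta)$ satisfies $E>0$. Then $\Theta_k$ is periodic and its period is given by $$T(E)=\frac{4\sqrt2}{k^2}\int_0^1\frac{d\theta}{\sqrt{(\Lambda_2(E)+\Lambda_1(E)\theta^2)(1-\theta^2)}} .$$ In particular, the map $E\mapsto T(E)$ is strictly decreasing on $(0,+\infty)$ and $$\lim_{E\downarrow0}T(E)=\frac{2\pi}{k\sqrt{k^2-P}}\quad (=+\infty\text{ if }k^2=P),\qquad \lim_{E\to+\infty}T(E)=0 .$$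
   Context: The energy is the quantity (constant along solutions) $$E(\alpha,\beta)=\frac{\dot\Theta_k^2}{2}+\frac{k^2(k^2-P)}{2}\Theta_k^2+\frac{k^4}{4}\Theta_k^4\equiv\frac{\beta^2}{2}+\frac{k^2(k^2-P)}{2}\alpha^2+\frac{k^4}{4}\alpha^4 .$$ For $E>0$ put $$\Lambda_1(E):=\frac{\sqrt{(k^2-P)^2+4E}+P-k^2}{k^2}>0,\qquad \Lambda_2(E):=\frac{\sqrt{(k^2-P)^2+4E}-P+k^2}{k^2}>0 .$$ The period means the smallest positive period. *)

(* Defs.v *)
(* Vanilla Rocq: the real numbers of Stdlib together with Coquelicot. *)
From Stdlib Require Import Reals.
From Coquelicot Require Import Coquelicot.
Open Scope R_scope.

(* The first conjunct is needed: [Derive] is total, so differentiability of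
   [Derive Theta] does not entail that of [Theta]. *)
Definition is_solution (k : nat) (P alpha beta : R) (Theta : R -> R) : Prop :=
  (forall t : R, ex_derive Theta t) /\
  (forall t : R, ex_derive (Derive Theta) t) /\
  (forall t : R,
     Derive (Derive Theta) t
     + INR k ^ 2 * (INR k ^ 2 - P) * Theta t + INR k ^ 4 * Theta t ^ 3 = 0) /\
  Theta 0 = alpha /\
  Derive Theta 0 = beta.

Definition energy (k : nat) (P alpha beta : R) : R :=
  beta ^ 2 / 2 + INR k ^ 2 * (INR k ^ 2 - P) / 2 * alpha ^ 2
  + INR k ^ 4 / 4 * alpha ^ 4.

Definition Lambda1 (k : nat) (P E : R) : R :=
  (sqrt ((INR k ^ 2 - P) ^ 2 + 4 * E) + P - INR k ^ 2) / INR k ^ 2.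

Definition Lambda2 (k : nat) (P E : R) : R :=
  (sqrt ((INR k ^ 2 - P) ^ 2 + 4 * E) - P + INR k ^ 2) / INR k ^ 2.

Definition period_integrand (k : nat) (P E theta : R) : R :=
  1 / sqrt ((Lambda2 k P E + Lambda1 k P E * theta ^ 2) * (1 - theta ^ 2)).

(* The integrand is singular at 1, so the integral is an improper Riemann
   integral.  [RInt_gen] is total: its value is meaningful only when
   [ex_RInt_gen] holds for the same integrand and filters. *)
Definition period_fun (k : nat) (P E : R) : R :=
  4 * sqrt 2 / INR k ^ 2
  * RInt_gen (period_integrand k P E) (at_point 0) (at_left 1).

Definition is_positive_period (f : R -> R) (T : R) : Prop :=
  0 < T /\ forall t : R, f (t + T) = f t.

Definition is_smallest_period (f : R -> R) (T : R) : Prop :=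
  is_positive_period f T /\
  forall T' : R, is_positive_period f T' -> T <= T'.

(* Main.v *)
(* With [w = k^2 / sqrt 2], energy conservation reads
   [Theta'^2 = w^2 (Lambda1 - Theta^2) (Lambda2 + Theta^2)].  Hence
   [(Theta, Theta' / (w sqrt (Lambda2 + Theta^2))) / sqrt Lambda1] is a unit vector
   [(sin phi, cos phi)], and its phase turns at the positive speed
   [w sqrt (Lambda2 + Lambda1 sin^2 phi)].  The period is the time [phi] needs to
   increase by [2 PI]; by symmetry it is four times the time from [0] to [PI / 2], which
   the substitution [theta = sin phi] turns into the integral of the statement.  In
   the variable [phi] the integral is proper, so monotonicity in [E] is pointwise, and
   the limits follow from bounding the integrand between [1 / sqrt (Lambda2 + Lambda1)]
   and [1 / sqrt Lambda2]. *)
Require Import Defs.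
From Stdlib Require Import Reals Lra Lia Psatz.
From Coquelicot Require Import Coquelicot.
Open Scope R_scope.
Set Bullet Behavior "Strict Subproofs".

(** * Tools: functions with zero derivative, and angles of unit vectors *)

(** Mean value theorem. Symmetries of [elapsed], conservation of energy and the phase equations are
    all reduced to a vanishing derivative. *)
Lemma derive_zero_const (f : R -> R) :
  (forall t, is_derive f t 0) -> forall x y, f x = f y.
Proof.
  intros H x y.
  destruct (MVT_gen f y x (fun _ => 0)) as [c [_ Hc]].
  - intros t _; apply H.
  - intros t _; apply continuity_pt_filterlim, (ex_derive_continuous f).
    exists 0; apply H.
  - lra.
Qed.

(** Both [asin u] and [PI - asin u] have sine [u]; the sign of [v] decides which one has cosine
    [v]. *)
Lemma angle_of_unit_vector (u v : R) :
  u ^ 2 + v ^ 2 = 1 -> exists a, sin a = u /\ cos a = v.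
Proof.
  intros H.
  assert (Hu : -1 <= u <= 1) by nra.
  assert (Hs : sqrt (1 - Rsqr u) = Rabs v).
  { rewrite <- sqrt_Rsqr_abs; f_equal; unfold Rsqr; lra. }
  destruct (Rle_dec 0 v) as [Hv|Hv].
  - exists (asin u); split; [now apply sin_asin|].
    rewrite cos_asin, Hs by assumption; now apply Rabs_pos_eq.
  - exists (PI - asin u); split.
    + rewrite sin_PI_x; now apply sin_asin.
    + replace (PI - asin u) with (- asin u + PI) by ring.
      rewrite neg_cos, cos_neg, cos_asin, Hs by assumption.
      rewrite Rabs_left; lra.
Qed.

(* The form in which [auto_derive] leaves derivatives of abstract functions. *)
Lemma Derive_eta (f : R -> R) (t l : R) :
  is_derive f t l -> Derive (fun s => f s) t = l.
Proof. apply is_derive_unique. Qed.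

(** * Time as a function of the phase, and its symmetries *)

(* Up to the factor [w], the time spent per unit of phase. *)
Definition time_density (p q x : R) : R := / sqrt (p + q * sin x ^ 2).

(** For [p > 0], this is the incomplete elliptic integral of the first kind with parameter
    [- q / p], divided by [sqrt p]. *)
Definition elapsed (p q x : R) : R := RInt (time_density p q) 0 x.

Lemma time_density_radicand_pos (p q x : R) :
  0 < p -> 0 <= q -> 0 < p + q * sin x ^ 2.
Proof. intros Hp Hq; generalize (pow2_ge_0 (sin x)); nra. Qed.

Lemma time_density_pos (p q x : R) : 0 < p -> 0 <= q -> 0 < time_density p q x.
Proof.
  intros Hp Hq; apply Rinv_0_lt_compat, sqrt_lt_R0.
  now apply time_density_radicand_pos.
Qed.

Lemma time_density_continuous (p q x : R) :
  0 < p -> 0 <= q -> continuous (time_density p q) x.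
Proof.
  intros Hp Hq; generalize (time_density_radicand_pos p q x Hp Hq); intros H.
  apply (ex_derive_continuous (time_density p q)).
  unfold time_density; auto_derive.
  replace (sin x * (sin x * 1)) with (sin x ^ 2) by ring.
  repeat split; try lra.
  apply Rgt_not_eq, sqrt_lt_R0; lra.
Qed.

Lemma time_density_ex_RInt (p q a b : R) :
  0 < p -> 0 <= q -> ex_RInt (time_density p q) a b.
Proof.
  intros; apply (ex_RInt_continuous (time_density p q)); intros.
  now apply time_density_continuous.
Qed.

Lemma elapsed_derive (p q x : R) :
  0 < p -> 0 <= q -> is_derive (elapsed p q) x (time_density p q x).
Proof.
  intros Hp Hq; apply (is_derive_RInt (time_density p q) _ 0).
  - exists (mkposreal 1 Rlt_0_1); intros y _.
    now apply (RInt_correct (time_density p q)), time_density_ex_RInt.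
  - now apply time_density_continuous.
Qed.

Lemma elapsed_0 (p q : R) : elapsed p q 0 = 0.
Proof. apply (RInt_point 0 (time_density p q)). Qed.

Lemma elapsed_increasing (p q x y : R) :
  0 < p -> 0 <= q -> x < y -> elapsed p q x < elapsed p q y.
Proof.
  intros Hp Hq Hxy.
  destruct (MVT_gen (elapsed p q) x y (time_density p q)) as [c [_ Hc]].
  - intros; now apply elapsed_derive.
  - intros t _; apply continuity_pt_filterlim, (ex_derive_continuous (elapsed p q)).
    exists (time_density p q t); now apply elapsed_derive.
  - generalize (time_density_pos p q c Hp Hq); nra.
Qed.

(** Turns equalities between times into equalities between phases. *)
Lemma elapsed_injective (p q x y : R) :
  0 < p -> 0 <= q -> elapsed p q x = elapsed p q y -> x = y.
Proof.
  intros Hp Hq H; destruct (Rtotal_order x y) as [Hlt|[Heq|Hlt]]; auto.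
  - generalize (elapsed_increasing p q x y Hp Hq Hlt); lra.
  - generalize (elapsed_increasing p q y x Hp Hq Hlt); lra.
Qed.

(** The density is even, so the sum of the two sides has zero derivative. *)
Lemma elapsed_opp (p q x : R) :
  0 < p -> 0 <= q -> elapsed p q (- x) = - elapsed p q x.
Proof.
  intros Hp Hq.
  enough (elapsed p q (- x) + elapsed p q x = elapsed p q (- 0) + elapsed p q 0)
    by (rewrite Ropp_0, elapsed_0 in H; lra).
  apply (derive_zero_const (fun y => elapsed p q (- y) + elapsed p q y)).
  intros t.
  replace 0 with (plus (scal (- 1) (time_density p q (- t))) (time_density p q t)).
  - apply (is_derive_plus (fun y => elapsed p q (- y)) (elapsed p q)).
    + apply (is_derive_comp (elapsed p q) Ropp).
      * now apply elapsed_derive.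
      * auto_derive; auto.
    + now apply elapsed_derive.
  - unfold plus, scal; simpl; unfold mult; simpl; unfold time_density.
    rewrite sin_neg; replace ((- sin t) ^ 2) with (sin t ^ 2) by ring; ring.
Qed.

(** The density depends on [sin x ^ 2] only, hence is [PI]-periodic, and each half turn costs the
    same time. *)
Lemma elapsed_add_PI (p q x : R) :
  0 < p -> 0 <= q -> elapsed p q (x + PI) = elapsed p q x + elapsed p q PI.
Proof.
  intros Hp Hq.
  enough (elapsed p q (x + PI) - elapsed p q x
          = elapsed p q (0 + PI) - elapsed p q 0)
    by (rewrite Rplus_0_l, elapsed_0 in H; lra).
  apply (derive_zero_const (fun y => elapsed p q (y + PI) - elapsed p q y)).
  intros t.
  replace 0 with (minus (scal 1 (time_density p q (t + PI))) (time_density p q t)).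
  - apply (is_derive_minus (fun y => elapsed p q (y + PI)) (elapsed p q)).
    + apply (is_derive_comp (elapsed p q) (fun y => y + PI)).
      * now apply elapsed_derive.
      * auto_derive; auto.
    + now apply elapsed_derive.
  - unfold minus, plus, opp, scal; simpl; unfold mult; simpl; unfold time_density.
    rewrite neg_sin; replace ((- sin t) ^ 2) with (sin t ^ 2) by ring; ring.
Qed.

(** The half-turn rule at [- (PI / 2)] and oddness show that a half turn takes two quarter periods;
    a full turn is two half turns. *)
Lemma elapsed_add_2PI (p q x : R) :
  0 < p -> 0 <= q -> elapsed p q (x + 2 * PI) = elapsed p q x + 4 * elapsed p q (PI / 2).
Proof.
  intros Hp Hq.
  generalize (elapsed_add_PI p q (- (PI / 2)) Hp Hq).
  replace (- (PI / 2) + PI) with (PI / 2) by field.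
  rewrite elapsed_opp by assumption; intros H.
  replace (x + 2 * PI) with (x + PI + PI) by ring.
  rewrite !elapsed_add_PI by assumption; lra.
Qed.

(** * The quarter period as an improper integral *)

(** The derivative of [asin] supplies the singular factor [1 / sqrt (1 - x ^ 2)], so this is an
    antiderivative of the integrand on the open interval. *)
Lemma elapsed_asin_derive (p q x : R) :
  0 < p -> 0 <= q -> -1 < x < 1 ->
  is_derive (fun y => elapsed p q (asin y)) x
    (1 / sqrt ((p + q * x ^ 2) * (1 - x ^ 2))).
Proof.
  intros Hp Hq Hx.
  replace (1 / sqrt ((p + q * x ^ 2) * (1 - x ^ 2)))
    with (scal (1 / sqrt (1 - x²)) (time_density p q (asin x))).
  - apply (is_derive_comp (elapsed p q) asin).
    + now apply elapsed_derive.
    + apply is_derive_Reals.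
      rewrite <- (derive_pt_asin x Hx).
      apply (derive_pt_eq_1 _ _ _ (derivable_pt_asin x Hx)); reflexivity.
  - change (1 / sqrt (1 - x²) * time_density p q (asin x)
            = 1 / sqrt ((p + q * x ^ 2) * (1 - x ^ 2))).
    unfold time_density; rewrite Rsqr_pow2.
    assert (0 < p + q * x ^ 2) by (generalize (pow2_ge_0 x); nra).
    assert (0 < 1 - x ^ 2) by nra.
    rewrite sin_asin by lra.
    rewrite sqrt_mult by lra.
    field; split; apply Rgt_not_eq, sqrt_lt_R0; assumption.
Qed.

(* Substitution [x = sin phi]. *)
Lemma quarter_period_is_RInt_gen (p q : R) :
  0 < p -> 0 <= q ->
  is_RInt_gen (fun x => 1 / sqrt ((p + q * x ^ 2) * (1 - x ^ 2)))
    (at_point 0) (at_left 1) (elapsed p q (PI / 2)).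
Proof.
  intros Hp Hq.
  set (f := fun x => 1 / sqrt ((p + q * x ^ 2) * (1 - x ^ 2))).
  (* Away from 1 the integrand is continuous and the fundamental theorem of calculus applies; only
     [b -> 1] remains. *)
  assert (Hint : forall b, 0 <= b < 1 -> is_RInt f 0 b (elapsed p q (asin b))).
  { intros b Hb.
    replace (elapsed p q (asin b))
      with (minus (elapsed p q (asin b)) (elapsed p q (asin 0)))
      by (unfold minus, plus, opp; simpl; rewrite asin_0, elapsed_0; ring).
    apply (is_RInt_derive (fun y => elapsed p q (asin y))); intros x;
      rewrite Rmin_left, Rmax_right by lra; intros Hx.
    - apply elapsed_asin_derive; lra.
    - assert (0 < (p + q * x ^ 2) * (1 - x ^ 2))
        by (apply Rmult_lt_0_compat; [generalize (pow2_ge_0 x)|]; nra).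
      apply (ex_derive_continuous f); unfold f; auto_derive; simpl in H.
      repeat split; try lra.
      apply Rgt_not_eq, sqrt_lt_R0; lra. }
  apply filterlimi_locally; intros eps.
  assert (Hc : continuous (elapsed p q) (PI / 2)).
  { apply (ex_derive_continuous (elapsed p q)).
    exists (time_density p q (PI / 2)); now apply elapsed_derive. }
  destruct (proj1 (filterlim_locally _ _) Hc eps) as [d Hd].
  generalize PI_RGT_0 (cond_pos d); intros HPI Hdp.
  (* Upper limits [b] between [sin a] and 1 have [asin b] within [d] of [PI / 2]; the maximum keeps
     [a] where [sin] is monotone and nonnegative. *)
  set (a := Rmax 0 (PI / 2 - d / 2)).
  assert (Ha : 0 <= a < PI / 2).
  { unfold a; split; [apply Rmax_l|apply Rmax_lub_lt; lra]. }
  assert (Ha' : PI / 2 - d < a) by (unfold a; generalize (Rmax_r 0 (PI / 2 - d / 2)); lra).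
  assert (Hsa : 0 <= sin a < 1).
  { split; [apply sin_ge_0; lra|].
    rewrite <- sin_PI2; apply sin_increasing_1; lra. }
  exists (fun x => x = 0) (fun b => sin a < b < 1).
  - reflexivity.
  - exists (mkposreal (1 - sin a) ltac:(lra)); intros y Hy Hy1.
    apply Rabs_lt_between in Hy; unfold minus, plus, opp in Hy; simpl in Hy; lra.
  - intros x b -> Hb; simpl.
    exists (elapsed p q (asin b)); split; [apply Hint; lra|].
    apply Hd.
    generalize (asin_bound b); intros Hab.
    assert (a < asin b).
    { apply Rnot_le_lt; intros Hle.
      assert (sin (asin b) <= sin a) by (apply sin_incr_1; lra).
      rewrite sin_asin in H; lra. }
    apply Rabs_lt_between; unfold minus, plus, opp; simpl; lra.
Qed.

(** * Construction of the phase of a solution *)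

(** The phase is obtained by integrating its speed [h] from an angle of the initial unit vector.
    Both [(u, z)] and [(sin phi, cos phi)] then solve the same rotation system [u' = h z],
    [z' = - h u] with the same initial value, hence coincide. *)
Lemma phase_function (w p q : R) (x v : R -> R) :
  0 < w -> 0 < p -> 0 < q ->
  (forall t, is_derive x t (v t)) ->
  (forall t, is_derive v t (w ^ 2 * x t * (q - p - 2 * x t ^ 2))) ->
  (forall t, v t ^ 2 = w ^ 2 * (q - x t ^ 2) * (p + x t ^ 2)) ->
  exists phi : R -> R,
    forall t, is_derive phi t (w * sqrt (p + x t ^ 2)) /\ x t = sqrt q * sin (phi t).
Proof.
  intros Hw Hp Hq Hx Hv HE.
  set (h := fun t => w * sqrt (p + x t ^ 2)).
  assert (Hr : forall t, 0 < p + x t ^ 2) by (intros; generalize (pow2_ge_0 (x t)); lra).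
  assert (Hrs : forall t, 0 < sqrt (p + x t ^ 2)) by (intros; apply sqrt_lt_R0, Hr).
  assert (Hsq : 0 < sqrt q) by (now apply sqrt_lt_R0).
  assert (Hsq2 : sqrt q ^ 2 = q) by (apply pow2_sqrt; lra).
  assert (Hr2 : forall t, sqrt (p + x t ^ 2) ^ 2 = p + x t ^ 2)
    by (intros; apply pow2_sqrt; generalize (Hr t); lra).
  set (u := fun t => x t / sqrt q).
  set (z := fun t => v t / (sqrt q * h t)).
  assert (Hh0 : forall t, sqrt q * h t <> 0).
  { intros t; unfold h; generalize (Hrs t); intros.
    apply Rgt_not_eq; repeat apply Rmult_lt_0_compat; lra. }
  assert (Huz : forall t, u t ^ 2 + z t ^ 2 = 1).
  { intros t; unfold u, z, h; generalize (Hrs t) (Hr2 t); intros H1 H2.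
    rewrite !Rdiv_def, !Rpow_mult_distr, HE, !pow_inv, !Rpow_mult_distr, Hsq2, H2.
    field; generalize (Hr t); lra. }
  assert (Hh : forall t, continuous h t).
  { intros t; apply (ex_derive_continuous h); unfold h; auto_derive.
    generalize (Hr t); simpl; intros; repeat split; trivial.
    exists (v t); apply Hx. }
  destruct (angle_of_unit_vector (u 0) (z 0) (Huz 0)) as [a [Hsa Hca]].
  set (phi := fun t => a + RInt h 0 t).
  assert (Hphi : forall t, is_derive phi t (h t)).
  { intros t; unfold phi.
    replace (h t) with (plus 0 (h t)) by (unfold plus; simpl; ring).
    apply (is_derive_plus (fun _ => a) (RInt h 0)).
    - apply (is_derive_const a).
    - apply (is_derive_RInt h _ 0); [|apply Hh].
      exists (mkposreal 1 Rlt_0_1); intros y _.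
      apply (RInt_correct h), (ex_RInt_continuous h); intros; apply Hh. }
  assert (Hu : forall t, is_derive u t (h t * z t)).
  { intros t; unfold u, z.
    assert (ex_derive x t) by (exists (v t); apply Hx).
    auto_derive; trivial.
    rewrite (Derive_eta _ _ _ (Hx t)).
    field; split; [|lra]. unfold h; generalize (Hrs t); nra. }
  assert (Hz : forall t, is_derive z t (- (h t * u t))).
  { intros t; generalize (Hh0 t) (Hrs t) (Hr2 t) (HE t); unfold u, z, h; intros H0 H1 H2 H3.
    assert (ex_derive x t) by (exists (v t); apply Hx).
    assert (ex_derive v t) by (eexists; apply Hv).
    auto_derive.
    - generalize (Hr t); simpl; intros; repeat split; trivial.
    - replace (x t * (x t * 1)) with (x t ^ 2) by ring.
      rewrite (Derive_eta _ _ _ (Hx t)), (Derive_eta _ _ _ (Hv t)).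
      set (r := sqrt (p + x t ^ 2)) in *; clearbody r.
      set (s := sqrt q) in *; clearbody s.
      (* Clearing denominators leaves a polynomial identity, in which the energy relation [H3]
         eliminates [v t ^ 2]. *)
      apply (Rmult_eq_reg_r (s * r ^ 3 * w)); [|apply Rgt_not_eq; repeat apply Rmult_lt_0_compat; trivial; lra].
      transitivity (w ^ 2 * x t * (q - p - 2 * x t ^ 2) * r ^ 2 - v t ^ 2 * x t).
      { field. repeat split; lra. }
      transitivity (- (w ^ 2 * x t * r ^ 2 * r ^ 2)); [|field; lra].
      rewrite H3, H2; ring. }
  exists phi; intros t; split; [apply Hphi|].
  (* The squared distance between the two rotating vectors is constant, and it vanishes at time
     0. *)
  assert (H : (u t - sin (phi t)) ^ 2 + (z t - cos (phi t)) ^ 2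
              = (u 0 - sin (phi 0)) ^ 2 + (z 0 - cos (phi 0)) ^ 2).
  { apply (derive_zero_const (fun s => (u s - sin (phi s)) ^ 2 + (z s - cos (phi s)) ^ 2)).
    clear t; intros t.
    assert (ex_derive u t) by (eexists; apply Hu).
    assert (ex_derive z t) by (eexists; apply Hz).
    assert (ex_derive phi t) by (eexists; apply Hphi).
    auto_derive; [repeat split; trivial|].
    rewrite (Derive_eta _ _ _ (Hu t)), (Derive_eta _ _ _ (Hz t)),
      (Derive_eta _ _ _ (Hphi t)).
    ring. }
  assert (H0 : phi 0 = a).
  { unfold phi; rewrite RInt_point; unfold zero; simpl; ring. }
  rewrite H0, Hsa, Hca in H.
  assert (Hut : u t = sin (phi t)).
  { generalize (pow2_ge_0 (z t - cos (phi t))); intros.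
    assert ((u t - sin (phi t)) ^ 2 = 0) by (generalize (pow2_ge_0 (u t - sin (phi t))); lra).
    enough (u t - sin (phi t) = 0) by lra.
    apply (Rsqr_eq_0); unfold Rsqr; lra. }
  rewrite <- Hut; unfold u; field; lra.
Qed.

(** * Bounds and monotonicity of the quarter period *)

(** Compare with constant integrands, using [0 <= sin x ^ 2 <= 1]. *)
Lemma quarter_period_bounds (p q : R) :
  0 < p -> 0 <= q ->
  PI / 2 / sqrt (p + q) <= elapsed p q (PI / 2) <= PI / 2 / sqrt p.
Proof.
  intros Hp Hq; generalize PI_RGT_0; intros HPI.
  assert (Hconst : forall c, RInt (fun _ => c) 0 (PI / 2) = PI / 2 * c).
  { intros c; rewrite RInt_const; unfold scal; simpl; unfold mult; simpl; ring. }
  assert (Hsin : forall x, 0 <= sin x ^ 2 <= 1).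
  { intros x; generalize (SIN_bound x); nra. }
  unfold elapsed; rewrite (Rdiv_def _ (sqrt (p + q))), (Rdiv_def _ (sqrt p)), <- !Hconst.
  split; apply RInt_le; try lra.
  - apply ex_RInt_const.
  - now apply time_density_ex_RInt.
  - intros x _; apply Rinv_le_contravar.
    + now apply sqrt_lt_R0, time_density_radicand_pos.
    + apply sqrt_le_1_alt; generalize (Hsin x); nra.
  - now apply time_density_ex_RInt.
  - apply ex_RInt_const.
  - intros x _; apply Rinv_le_contravar.
    + now apply sqrt_lt_R0.
    + apply sqrt_le_1_alt; generalize (Hsin x); nra.
Qed.

(** Pointwise comparison of the densities; [p < p'] makes it strict even where [sin x] vanishes. *)
Lemma quarter_period_decreasing (p q p' q' : R) :
  0 < p -> 0 <= q -> p < p' -> q <= q' ->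
  elapsed p' q' (PI / 2) < elapsed p q (PI / 2).
Proof.
  intros Hp Hq Hpp Hqq; generalize PI_RGT_0; intros HPI.
  apply RInt_lt; [lra|intros; apply time_density_continuous; lra..|].
  intros x _; generalize (pow2_ge_0 (sin x)); intros Hs.
  unfold time_density; apply Rinv_0_lt_contravar.
  - apply sqrt_lt_R0; nra.
  - apply sqrt_lt_1; nra.
Qed.

(** * The constants [Lambda1] and [Lambda2] *)

Lemma sqrt_discriminant_gt (c E : R) :
  0 <= c -> 0 < E -> c < sqrt (c ^ 2 + 4 * E).
Proof.
  intros Hc HE; rewrite <- (sqrt_pow2 c Hc) at 1; apply sqrt_lt_1;
    generalize (pow2_ge_0 c); lra.
Qed.

Lemma INR_pos (k : nat) : (1 <= k)%nat -> 0 < INR k.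
Proof. intros; apply lt_0_INR; lia. Qed.

Lemma Lambda1_pos (k : nat) (P E : R) :
  (1 <= k)%nat -> P <= INR k ^ 2 -> 0 < E -> 0 < Lambda1 k P E.
Proof.
  intros hk hP HE; unfold Lambda1.
  generalize (sqrt_discriminant_gt (INR k ^ 2 - P) E ltac:(lra) HE); intros.
  apply Rdiv_lt_0_compat; [lra|now apply pow_lt, INR_pos].
Qed.

Lemma Lambda2_pos (k : nat) (P E : R) :
  (1 <= k)%nat -> P <= INR k ^ 2 -> 0 < E -> 0 < Lambda2 k P E.
Proof.
  intros hk hP HE; unfold Lambda2.
  generalize (sqrt_discriminant_gt (INR k ^ 2 - P) E ltac:(lra) HE); intros.
  apply Rdiv_lt_0_compat; [lra|now apply pow_lt, INR_pos].
Qed.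

Lemma Lambda_sum (k : nat) (P E : R) :
  Lambda2 k P E + Lambda1 k P E
  = 2 * sqrt ((INR k ^ 2 - P) ^ 2 + 4 * E) / INR k ^ 2.
Proof. unfold Lambda1, Lambda2, Rdiv; ring. Qed.

(** [Lambda1] and [- Lambda2] are the roots, in the squared amplitude, of the energy equation with
    zero velocity. This identity and the next are Vieta's relations. *)
Lemma Lambda_diff (k : nat) (P E : R) :
  (1 <= k)%nat ->
  INR k ^ 2 * (Lambda1 k P E - Lambda2 k P E) = - 2 * (INR k ^ 2 - P).
Proof.
  intros hk; generalize (INR_pos k hk); intros.
  unfold Lambda1, Lambda2; field; lra.
Qed.

Lemma Lambda_prod (k : nat) (P E : R) :
  (1 <= k)%nat -> 0 < E ->
  INR k ^ 4 * (Lambda1 k P E * Lambda2 k P E) = 4 * E.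
Proof.
  intros hk HE; generalize (INR_pos k hk); intros.
  assert (Hs : sqrt ((INR k ^ 2 - P) ^ 2 + 4 * E) ^ 2 = (INR k ^ 2 - P) ^ 2 + 4 * E)
    by (apply pow2_sqrt; generalize (pow2_ge_0 (INR k ^ 2 - P)); lra).
  unfold Lambda1, Lambda2.
  set (s := sqrt ((INR k ^ 2 - P) ^ 2 + 4 * E)) in *; clearbody s.
  transitivity (s ^ 2 - (INR k ^ 2 - P) ^ 2); [field; lra|rewrite Hs; ring].
Qed.

(** * The period as a function of the energy: monotonicity and limits *)

Lemma is_RInt_gen_period_integrand (k : nat) (P E : R) :
  (1 <= k)%nat -> P <= INR k ^ 2 -> 0 < E ->
  is_RInt_gen (period_integrand k P E) (at_point 0) (at_left 1)
    (elapsed (Lambda2 k P E) (Lambda1 k P E) (PI / 2)).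
Proof.
  intros; apply quarter_period_is_RInt_gen.
  - now apply Lambda2_pos.
  - now apply Rlt_le, Lambda1_pos.
Qed.

Lemma period_fun_elapsed (k : nat) (P E : R) :
  (1 <= k)%nat -> P <= INR k ^ 2 -> 0 < E ->
  period_fun k P E
  = 4 * sqrt 2 / INR k ^ 2 * elapsed (Lambda2 k P E) (Lambda1 k P E) (PI / 2).
Proof.
  intros hk hP HE; unfold period_fun; f_equal.
  now apply is_RInt_gen_unique, is_RInt_gen_period_integrand.
Qed.

Lemma period_factor_pos (k : nat) : (1 <= k)%nat -> 0 < 4 * sqrt 2 / INR k ^ 2.
Proof.
  intros hk; apply Rdiv_lt_0_compat; [|now apply pow_lt, INR_pos].
  generalize (sqrt_lt_R0 2); lra.
Qed.

Lemma period_fun_bounds (k : nat) (P E : R) :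
  (1 <= k)%nat -> P <= INR k ^ 2 -> 0 < E ->
  4 * sqrt 2 / INR k ^ 2 * (PI / 2 / sqrt (Lambda2 k P E + Lambda1 k P E))
  <= period_fun k P E
  <= 4 * sqrt 2 / INR k ^ 2 * (PI / 2 / sqrt (Lambda2 k P E)).
Proof.
  intros hk hP HE; rewrite period_fun_elapsed by assumption.
  destruct (quarter_period_bounds (Lambda2 k P E) (Lambda1 k P E)).
  - now apply Lambda2_pos.
  - now apply Rlt_le, Lambda1_pos.
  - generalize (period_factor_pos k hk); split; apply Rmult_le_compat_l; lra.
Qed.

(** Both [Lambda1] and [Lambda2] increase with the energy through their common square root. *)
Lemma period_fun_decreasing (k : nat) (P E1 E2 : R) :
  (1 <= k)%nat -> P <= INR k ^ 2 -> 0 < E1 -> E1 < E2 ->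
  period_fun k P E2 < period_fun k P E1.
Proof.
  intros hk hP HE1 HE2; rewrite !period_fun_elapsed by (assumption || lra).
  assert (Hs : sqrt ((INR k ^ 2 - P) ^ 2 + 4 * E1) < sqrt ((INR k ^ 2 - P) ^ 2 + 4 * E2))
    by (apply sqrt_lt_1; generalize (pow2_ge_0 (INR k ^ 2 - P)); lra).
  assert (0 < / INR k ^ 2) by (apply Rinv_0_lt_compat, pow_lt, INR_pos, hk).
  apply Rmult_lt_compat_l; [now apply period_factor_pos|].
  apply quarter_period_decreasing.
  - now apply Lambda2_pos.
  - now apply Rlt_le, Lambda1_pos.
  - apply Rmult_lt_compat_r; lra.
  - apply Rmult_le_compat_r; lra.
Qed.

Lemma at_right_pos : at_right 0 (fun E => 0 < E).
Proof. exists (mkposreal 1 Rlt_0_1); auto. Qed.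

(** Squeeze: [Lambda1] vanishes at [E = 0], so the two bounds on the period have the same limit. *)
Lemma period_fun_lim_0 (k : nat) (P : R) :
  (1 <= k)%nat -> P < INR k ^ 2 ->
  filterlim (period_fun k P) (at_right 0)
    (locally (2 * PI / (INR k * sqrt (INR k ^ 2 - P)))).
Proof.
  intros hk hP; generalize (INR_pos k hk); intros Hk.
  set (c := INR k ^ 2 - P).
  assert (Hc : 0 < c) by (unfold c; lra).
  assert (Hc2 : 0 < c ^ 2) by (apply pow_lt, Hc).
  assert (Hsc : sqrt (c ^ 2 + 4 * 0) = c)
    by (rewrite Rmult_0_r, Rplus_0_r; apply sqrt_pow2; lra).
  (* To be used with [f] equal to [Lambda2 + Lambda1] and to [Lambda2]. As [c > 0], the bounds are
     continuous at 0, so the one-sided limit is their value there. *)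
  assert (HL : forall f : R -> R, continuous f 0 -> f 0 = 2 * c / INR k ^ 2 ->
    filterlim (fun E => 4 * sqrt 2 / INR k ^ 2 * (PI / 2 / sqrt (f E)))
      (at_right 0) (locally (2 * PI / (INR k * sqrt c)))).
  { intros f Hf Hf0.
    assert (Hpos : 0 < 2 * c / INR k ^ 2)
      by (apply Rdiv_lt_0_compat; [lra|now apply pow_lt]).
    apply (filterlim_filter_le_1 (F := locally 0)); [apply filter_le_within|].
    replace (2 * PI / (INR k * sqrt c))
      with (4 * sqrt 2 / INR k ^ 2 * (PI / 2 / sqrt (f 0))).
    - apply (continuous_comp f (fun y => 4 * sqrt 2 / INR k ^ 2 * (PI / 2 / sqrt y)));
        [exact Hf|].
      apply (ex_derive_continuous (fun y => 4 * sqrt 2 / INR k ^ 2 * (PI / 2 / sqrt y))).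
      rewrite Hf0; auto_derive; repeat split; trivial.
      apply Rgt_not_eq, sqrt_lt_R0, Hpos.
    - rewrite Hf0, sqrt_div_alt, sqrt_mult, sqrt_pow2 by (lra || now apply pow_lt).
      assert (0 < sqrt 2) by (apply sqrt_lt_R0; lra).
      assert (0 < sqrt c) by (now apply sqrt_lt_R0).
      field; lra. }
  apply (filterlim_le_le 
    (fun E => 4 * sqrt 2 / INR k ^ 2 * (PI / 2 / sqrt (Lambda2 k P E + Lambda1 k P E)))
    (period_fun k P)
    (fun E => 4 * sqrt 2 / INR k ^ 2 * (PI / 2 / sqrt (Lambda2 k P E)))
    (Finite (2 * PI / (INR k * sqrt c)))).
  - generalize at_right_pos; apply filter_imp; intros E HE.
    apply period_fun_bounds; trivial; lra.
  - apply (HL (fun E => Lambda2 k P E + Lambda1 k P E)).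
    + apply (ex_derive_continuous (fun E => Lambda2 k P E + Lambda1 k P E)).
      unfold Lambda1, Lambda2; fold c; auto_derive; simpl in Hc2; lra.
    + rewrite Lambda_sum; fold c; rewrite Hsc; reflexivity.
  - apply (HL (Lambda2 k P)).
    + apply (ex_derive_continuous (Lambda2 k P)).
      unfold Lambda2; fold c; auto_derive; simpl in Hc2; lra.
    + unfold Lambda2; fold c; rewrite Hsc; unfold c; f_equal; ring.
Qed.

(** Here [Lambda2 + Lambda1] tends to 0 with [E], so the lower bound on the period blows up. *)
Lemma period_fun_lim_0_degenerate (k : nat) (P : R) :
  (1 <= k)%nat -> P = INR k ^ 2 ->
  filterlim (period_fun k P) (at_right 0) (Rbar_locally p_infty).
Proof.
  intros hk hP; generalize (INR_pos k hk); intros Hk.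
  set (C := 4 * sqrt 2 / INR k ^ 2 * (PI / 2)).
  assert (HC : 0 < C).
  { apply Rmult_lt_0_compat; [now apply period_factor_pos|generalize PI_RGT_0; lra]. }
  (* [D E] is [sqrt (Lambda2 + Lambda1)], and [C / D E] is the lower bound. *)
  set (D := fun E => sqrt (2 * sqrt ((INR k ^ 2 - P) ^ 2 + 4 * E) / INR k ^ 2)).
  assert (HD : continuous D 0).
  { unfold D; apply continuous_sqrt_comp.
    apply (continuous_mult (fun E => 2 * sqrt ((INR k ^ 2 - P) ^ 2 + 4 * E))
             (fun _ => / INR k ^ 2)); [|apply continuous_const].
    apply (continuous_mult (fun _ => 2)
             (fun E => sqrt ((INR k ^ 2 - P) ^ 2 + 4 * E))); [apply continuous_const|].
    apply continuous_sqrt_comp.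
    apply (ex_derive_continuous (fun E => (INR k ^ 2 - P) ^ 2 + 4 * E)).
    auto_derive; trivial. }
  assert (HD0 : D 0 = 0).
  { unfold D; rewrite hP.
    replace ((INR k ^ 2 - INR k ^ 2) ^ 2 + 4 * 0) with 0 by ring.
    rewrite sqrt_0, Rmult_0_r; unfold Rdiv; rewrite Rmult_0_l; apply sqrt_0. }
  intros Q [M HM].
  assert (HM1 : 0 < Rabs M + 1) by (generalize (Rabs_pos M); lra).
  (* [D E] below this threshold gives [C / D E > Rabs M + 1 > M]; adding 1 keeps the denominator
     positive. *)
  assert (Heps : 0 < C / (Rabs M + 1)) by (now apply Rdiv_lt_0_compat).
  destruct (proj1 (filterlim_locally _ _) HD (mkposreal _ Heps)) as [d Hd].
  exists d; intros E HEd HE.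
  generalize (Hd E HEd); rewrite HD0; intros HDE.
  apply Rabs_lt_between in HDE; unfold minus, plus, opp in HDE; simpl in HDE.
  apply HM.
  apply Rlt_le_trans with (C / D E).
  - assert (HDp : 0 < D E).
    { apply sqrt_lt_R0, Rdiv_lt_0_compat; [|now apply pow_lt].
      apply Rmult_lt_0_compat; [lra|].
      apply sqrt_lt_R0; generalize (pow2_ge_0 (INR k ^ 2 - P)); lra. }
    apply Rle_lt_trans with (Rabs M); [apply Rle_abs|].
    apply Rlt_trans with (Rabs M + 1); [lra|].
    apply (Rmult_lt_reg_r (D E)); trivial.
    replace (C / D E * D E) with (C / (Rabs M + 1) * (Rabs M + 1)) by (field; lra).
    rewrite (Rmult_comm (Rabs M + 1)); apply Rmult_lt_compat_r; lra.
  - destruct (period_fun_bounds k P E hk) as [Hlo _]; [lra|exact HE|].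
    rewrite Lambda_sum in Hlo.
    unfold C, Rdiv; rewrite Rmult_assoc; exact Hlo.
Qed.

Lemma period_fun_lim_infty (k : nat) (P : R) :
  (1 <= k)%nat -> P <= INR k ^ 2 ->
  filterlim (period_fun k P) (Rbar_locally p_infty) (locally 0).
Proof.
  intros hk hP; generalize (INR_pos k hk); intros Hk.
  set (C := 4 * sqrt 2 / INR k ^ 2 * (PI / 2)).
  assert (HC : 0 < C).
  { apply Rmult_lt_0_compat; [now apply period_factor_pos|generalize PI_RGT_0; lra]. }
  apply filterlim_locally; intros eps; generalize (cond_pos eps); intros Heps.
  (* The upper bound [C / sqrt Lambda2] is below [eps] once [sqrt Lambda2 > A]. *)
  set (A := C / eps).
  assert (HA : 0 < A) by (now apply Rdiv_lt_0_compat).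
  assert (HK2 : 0 < INR k ^ 2) by (now apply pow_lt).
  assert (HKA : 0 < INR k ^ 2 * A ^ 2) by (apply Rmult_lt_0_compat; trivial; now apply pow_lt).
  (* Beyond this energy the square root of the discriminant exceeds [INR k ^ 2 * A ^ 2], which
     forces [Lambda2 > A ^ 2]. *)
  exists ((INR k ^ 2 * A ^ 2) ^ 2); intros E HE.
  assert (HE0 : 0 < E) by (generalize (pow2_ge_0 (INR k ^ 2 * A ^ 2)); lra).
  assert (HsE : INR k ^ 2 * A ^ 2 < sqrt ((INR k ^ 2 - P) ^ 2 + 4 * E)).
  { rewrite <- (sqrt_pow2 (INR k ^ 2 * A ^ 2)) by lra.
    apply sqrt_lt_1; generalize (pow2_ge_0 (INR k ^ 2 - P)) (pow2_ge_0 (INR k ^ 2 * A ^ 2)); lra. }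
  assert (HL2 : A ^ 2 < Lambda2 k P E).
  { unfold Lambda2; apply (Rmult_lt_reg_r (INR k ^ 2)); trivial.
    unfold Rdiv; rewrite (Rmult_assoc _ (/ _)), Rinv_l by lra; lra. }
  assert (HsA : A < sqrt (Lambda2 k P E)).
  { rewrite <- (sqrt_pow2 A) by lra.
    apply sqrt_lt_1; generalize (pow2_ge_0 A); lra. }
  destruct (period_fun_bounds k P E hk hP HE0) as [Hlo Hhi].
  assert (0 < period_fun k P E).
  { eapply Rlt_le_trans; [|exact Hlo].
    apply Rmult_lt_0_compat; [now apply period_factor_pos|].
    apply Rdiv_lt_0_compat; [generalize PI_RGT_0; lra|].
    apply sqrt_lt_R0, Rplus_lt_0_compat; [now apply Lambda2_pos|now apply Lambda1_pos]. }
  assert (period_fun k P E < eps).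
  { eapply Rle_lt_trans; [exact Hhi|].
    unfold Rdiv at 2; rewrite <- Rmult_assoc; fold C.
    replace (pos eps) with (C * / A) by (unfold A; field; lra).
    apply Rmult_lt_compat_l; trivial.
    apply Rinv_0_lt_contravar; trivial. }
  apply Rabs_lt_between; unfold minus, plus, opp; simpl; lra.
Qed.

(** * Energy of a solution, and its smallest period *)

(** No term is negative. If [beta = 0], the quartic term is positive, also when [P = INR k ^ 2]. *)
Lemma energy_pos (k : nat) (P alpha beta : R) :
  (1 <= k)%nat -> P <= INR k ^ 2 -> (alpha, beta) <> (0, 0) ->
  0 < energy k P alpha beta.
Proof.
  intros hk hP Hne; generalize (INR_pos k hk); intros Hk.
  assert (HK2 : 0 < INR k ^ 2) by (now apply pow_lt).
  assert (HK4 : 0 < INR k ^ 4) by (now apply pow_lt).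
  assert (H1 : 0 <= INR k ^ 2 * (INR k ^ 2 - P) / 2 * alpha ^ 2).
  { apply Rmult_le_pos; [|apply pow2_ge_0]. nra. }
  unfold energy; replace (alpha ^ 4) with ((alpha ^ 2) ^ 2) by ring.
  assert (0 <= INR k ^ 4 / 4 * (alpha ^ 2) ^ 2)
    by (apply Rmult_le_pos; [lra|apply pow2_ge_0]).
  destruct (Req_dec beta 0) as [->|Hb].
  - assert (Ha : alpha <> 0) by (intros ->; now apply Hne).
    assert (0 < INR k ^ 4 / 4 * (alpha ^ 2) ^ 2).
    { apply Rmult_lt_0_compat; [lra|]. now apply pow_lt, pow2_gt_0. }
    lra.
  - generalize (pow2_gt_0 beta Hb); lra.
Qed.

(** The derivative of the energy is [Derive Theta] times the left side of the differential
    equation. *)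
Lemma energy_conserved (k : nat) (P alpha beta : R) (Theta : R -> R) (t : R) :
  is_solution k P alpha beta Theta ->
  energy k P (Theta t) (Derive Theta t) = energy k P alpha beta.
Proof.
  intros (H1 & H2 & Hode & <- & <-).
  apply (derive_zero_const (fun s => energy k P (Theta s) (Derive Theta s))).
  clear t; intros t; unfold energy; auto_derive.
  - repeat split; trivial; apply H1 || apply H2.
  - rewrite (Derive_eta _ _ _ (Derive_correct _ _ (H1 t))).
    rewrite (Derive_eta _ _ _ (Derive_correct _ _ (H2 t))).
    transitivity (Derive Theta t * (Derive (Derive Theta) t
      + INR k ^ 2 * (INR k ^ 2 - P) * Theta t + INR k ^ 4 * Theta t ^ 3)); [field|].
    rewrite Hode; ring.
Qed.

(** Measured by [elapsed], the phase advances linearly in time, at rate [w]. One period is thus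
    exactly one full turn, and a shorter shift misses the next maximum. *)
Lemma solution_smallest_period (k : nat) (P alpha beta : R) (Theta : R -> R) :
  (1 <= k)%nat -> P <= INR k ^ 2 -> (alpha, beta) <> (0, 0) ->
  is_solution k P alpha beta Theta ->
  is_smallest_period Theta (period_fun k P (energy k P alpha beta)).
Proof.
  intros hk hP Hne Hsol.
  generalize (energy_pos k P alpha beta hk hP Hne).
  generalize (fun t => energy_conserved k P alpha beta Theta t Hsol).
  generalize (energy k P alpha beta); intros E Hcons HE.
  destruct Hsol as (H1 & H2 & Hode & _ & _).
  generalize (INR_pos k hk) (Lambda1_pos k P E hk hP HE) (Lambda2_pos k P E hk hP HE)
    (Lambda_diff k P E hk) (Lambda_prod k P E hk HE) (period_fun_elapsed k P E hk hP HE).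
  set (q := Lambda1 k P E); set (p := Lambda2 k P E).
  intros Hk Hq Hp Hdiff Hprod HT.
  assert (Hs2 : 0 < sqrt 2) by (apply sqrt_lt_R0; lra).
  assert (Hs22 : sqrt 2 ^ 2 = 2) by (apply pow2_sqrt; lra).
  assert (HK2 : 0 < INR k ^ 2) by (now apply pow_lt).
  set (w := INR k ^ 2 / sqrt 2).
  assert (Hw : 0 < w) by (now apply Rdiv_lt_0_compat).
  assert (Hw2 : w ^ 2 = INR k ^ 4 / 2).
  { transitivity (INR k ^ 4 / sqrt 2 ^ 2); [unfold w; field; lra|now rewrite Hs22]. }
  assert (HwT : w * period_fun k P E = 4 * elapsed p q (PI / 2)).
  { rewrite HT; unfold w; field; lra. }
  destruct (phase_function w p q Theta (Derive Theta)) as [phi Hphi]; trivial.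
  - intros t; apply Derive_correct, H1.
  - intros t.
    replace (w ^ 2 * Theta t * (q - p - 2 * Theta t ^ 2))
      with (Derive (Derive Theta) t); [apply Derive_correct, H2|].
    rewrite Hw2.
    (* Isolating [INR k ^ 2 * (q - p)] lets [Hdiff] recover the linear coefficient of the
       equation. *)
    replace (INR k ^ 4 / 2 * Theta t * (q - p - 2 * Theta t ^ 2))
      with (INR k ^ 2 / 2 * Theta t * (INR k ^ 2 * (q - p)) - INR k ^ 4 * Theta t ^ 3)
      by field.
    rewrite Hdiff; generalize (Hode t); lra.
  - intros t; rewrite Hw2.
    replace (INR k ^ 4 / 2 * (q - Theta t ^ 2) * (p + Theta t ^ 2))
      with (INR k ^ 4 * (q * p) / 2 + INR k ^ 2 / 2 * Theta t ^ 2 * (INR k ^ 2 * (q - p))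
            - INR k ^ 4 / 2 * Theta t ^ 4) by field.
    rewrite Hdiff, Hprod; generalize (Hcons t); unfold energy; lra.
  - assert (Hsq : 0 < sqrt q) by (now apply sqrt_lt_R0).
    assert (Hsq2 : sqrt q ^ 2 = q) by (apply pow2_sqrt; lra).
    assert (Hq0 : 0 <= q) by lra.
    (* As [Theta = sqrt q * sin phi], the speed of the phase and the time density are reciprocal up
       to [w]. *)
    assert (Hel : forall t, elapsed p q (phi t) = w * t + elapsed p q (phi 0)).
    { intros t.
      enough (elapsed p q (phi t) - w * t = elapsed p q (phi 0) - w * 0) by lra.
      apply (derive_zero_const (fun s => elapsed p q (phi s) - w * s)).
      clear t; intros t; destruct (Hphi t) as [Hd Hth].
      replace 0 with (minus (scal (w * sqrt (p + Theta t ^ 2)) (time_density p q (phi t))) w).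
      - apply (is_derive_minus (fun s => elapsed p q (phi s)) (fun s => w * s)).
        + apply (is_derive_comp (elapsed p q) phi); trivial.
          now apply elapsed_derive.
        + auto_derive; trivial; ring.
      - change (w * sqrt (p + Theta t ^ 2) * time_density p q (phi t) - w = 0).
        generalize (time_density_radicand_pos p q (phi t) Hp Hq0); intros Hr.
        apply sqrt_lt_R0 in Hr.
        unfold time_density; rewrite Hth, Rpow_mult_distr, Hsq2; field; lra. }
    assert (HTpos : 0 < period_fun k P E).
    { assert (0 < elapsed p q (PI / 2)).
      { rewrite <- (elapsed_0 p q); apply elapsed_increasing; trivial.
        generalize PI_RGT_0; lra. }
      apply (Rmult_lt_reg_l w); trivial; lra. }
    repeat split; trivial.
    + intros t.
      assert (Hshift : phi (t + period_fun k P E) = phi t + 2 * PI).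
      { apply (elapsed_injective p q); trivial.
        rewrite elapsed_add_2PI, !(Hel (_ + _)), (Hel t) by assumption; lra. }
      rewrite (proj2 (Hphi _)), Hshift, sin_plus, sin_2PI, cos_2PI, (proj2 (Hphi t)); ring.
    + intros T' [HT'0 Hper].
      apply Rnot_lt_le; intros Hlt.
      (* The phase is [PI / 2] at [t0], where [Theta] attains its maximum, and it
         stays strictly below [PI / 2 + 2 * PI] until one full period has passed. *)
      set (t0 := (elapsed p q (PI / 2) - elapsed p q (phi 0)) / w).
      assert (Ht0 : phi t0 = PI / 2).
      { apply (elapsed_injective p q); trivial.
        rewrite Hel; unfold t0; field; lra. }
      assert (Hel' : elapsed p q (phi (t0 + T')) = elapsed p q (PI / 2) + w * T').
      { rewrite <- Ht0, !(Hel (_ + _)), (Hel t0); ring. }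
      assert (Hlo : PI / 2 < phi (t0 + T')).
      { apply Rnot_le_lt; intros [Hle|Hle].
        - apply (elapsed_increasing p q) in Hle; trivial; nra.
        - rewrite Hle in Hel'; nra. }
      assert (Hhi : phi (t0 + T') < PI / 2 + 2 * PI).
      { assert (w * T' < w * period_fun k P E) by (now apply Rmult_lt_compat_l).
        apply Rnot_le_lt; intros [Hle|Hle].
        - apply (elapsed_increasing p q) in Hle; trivial.
          rewrite elapsed_add_2PI in Hle by assumption; lra.
        - rewrite <- Hle, elapsed_add_2PI in Hel' by assumption; lra. }
      assert (Hsin : sin (phi (t0 + T')) = 1).
      { generalize (Hper t0).
        rewrite (proj2 (Hphi (t0 + T'))), (proj2 (Hphi t0)), Ht0, sin_PI2; nra. }
      (* [z] lies strictly between 0 and [PI], so [sin z > 0]; but [1 = sin (PI / 2 + 2 * z) = cos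
         (2 * z) = 1 - 2 * sin z ^ 2] forces [sin z = 0]. *)
      set (z := (phi (t0 + T') - PI / 2) / 2).
      assert (Hz : 0 < sin z) by (apply sin_gt_0; unfold z; lra).
      replace (phi (t0 + T')) with (PI / 2 + 2 * z) in Hsin by (unfold z; field).
      rewrite <- cos_sin, cos_2a_sin in Hsin; nra.
Qed.

Theorem theorem1 (k : nat) (P : R) (hk : (1 <= k)%nat) (hP : P <= INR k ^ 2) :
  (forall E : R, 0 < E ->
     ex_RInt_gen (period_integrand k P E) (at_point 0) (at_left 1)) /\
  (forall (alpha beta : R) (Theta : R -> R),
     (alpha, beta) <> (0, 0) ->
     is_solution k P alpha beta Theta ->
     0 < energy k P alpha beta /\
     is_smallest_period Theta (period_fun k P (energy k P alpha beta))) /\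
  (forall E1 E2 : R, 0 < E1 -> E1 < E2 -> period_fun k P E2 < period_fun k P E1) /\
  (P < INR k ^ 2 ->
     filterlim (period_fun k P) (at_right 0)
       (locally (2 * PI / (INR k * sqrt (INR k ^ 2 - P))))) /\
  (P = INR k ^ 2 ->
     filterlim (period_fun k P) (at_right 0) (Rbar_locally p_infty)) /\
  filterlim (period_fun k P) (Rbar_locally p_infty) (locally 0).
Proof.
  repeat apply conj.
  - intros E HE; eexists; now apply is_RInt_gen_period_integrand.
  - intros alpha beta Theta Hne Hsol; split.
    + now apply energy_pos.
    + now apply solution_smallest_period.
  - intros E1 E2; now apply period_fun_decreasing.
  - now apply period_fun_lim_0.
  - now apply period_fun_lim_0_degenerate.
  - now apply period_fun_lim_infty.
Qed.
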